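(* Let (A1)–(A2) (written out in the context) hold and let $\mathbf{S}^k\in V_{\Delta x}^n$ be a solution to the finite-volume scheme $$\frac{\mathrm{m}(K)}{\Delta t}\Phi_K(S_{i,K}^k-S_{i,K}^{k-1})+\sum_{\sigma\in\mathcal{E}_K}F_{i,K,\sigma}(\mathbf{S}^k)=0,\quad K\in\mathcal{T},\ k\in\mathbb{N},\ i=1,\ldots,n,$$ $$F_{i,K,\sigma}(\mathbf{S}^k)=-\tau_\sigma c_{i,\sigma}^k a_\sigma^k\,\mathrm{D}_{K,\sigma}\Big(P_c(S^k)+\frac{\beta(S^k)-\beta(S^{k-1})}{\Delta t}\Big)-\tau_\sigma\sum_{j=1}^n M_{ij}(\mathbf{S}_\sigma^k)\,\mathrm{D}_{K,\sigma}\mu_j^k ,$$ (all quantities being defined in the context) satisfying $S_{i,K}^k>0$ and $0<S_K^k<1$. Then $$H_d(\mathbf{S}^k)+c_M\Delta t\sum_{\sigma\in\mathcal{E}}\tau_\sigma|\Pi(\mathrm{D}_{K,\sigma}\boldsymbol{\mu}^k)|^2+\Delta t\sum_{\sigma\in\mathcal{E}}\tau_\sigma\,\mathrm{D}_{K,\sigma}P_c(S^k)\,\mathrm{D}_{K,\sigma}\beta(S^k)\le H_d(\mathbf{S}^{k-1}).$$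
   Context: **Domain and data.** $\Omega\subset\mathbb{R}^d$ ($d\ge1$) is a bounded domain with $\partial\Omega=\Gamma_D\cup\Gamma_N$, $\Gamma_D\cap\Gamma_N=\emptyset$, $\Gamma_D$ of positive measure, $\Gamma_N$ open in $\partial\Omega$. $n$ is the number of components, $\mathcal{D}=\{\mathbf{S}\in\mathbb{R}^n: S_1,\ldots,S_n>0,\ \sum_{i=1}^n S_i<1\}$, and for $\mathbf{S}=(S_1,\ldots,S_n)$ we write $S=\sum_{i=1}^n S_i$. $S_1^D,\ldots,S_n^D$ are the given Dirichlet data, $S^D=\sum_i S_i^D$. **Nonlinearities.** $a(S)$ is the diffusion mobility, $b(S)$ the dynamic capillary pressure coefficient, $\beta'=b$, and $P_c(S)$ the (negative) static capillary pressure; $a,b$ are positive on $(0,1)$, and $\beta$ and $P_c$ are increasing. Put $$\psi(S)=\int_{S^D}^S\frac{b(y)}{a(y)}dy,\quad \Psi(S)=\int_{S^D}^S\int_{S^D}^z\frac{b(y)}{a(y)}dy\,dz,$$ $$E(\mathbf{S})=\sum_{i=1}^n S_i\log\frac{S_i}{S_i^D}-S\log\frac{S}{S^D}+\Psi(S),\quad \mu_i=\frac{\partial E}{\partial S_i}=\log\frac{S_i}{S}-\log\frac{S_i^D}{S^D}+\psi(S).$$ **Assumptions.** (A1) The porosity $\Phi:\Omega\to[0,1]$ is integrable with $\Phi\ge c_\Phi>0$ in $\Omega$; the initial data satisfy $H(\mathbf{S}^0)=\int_\Omega(\Phi E(\mathbf{S}^0)+\frac12|\nabla\beta(S^0)|^2)dx<\infty$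 and $S_i^0\ge c$, $S^0=\sum_i S_i^0\le1-c$ in $\Omega$ for some $c\in(0,1)$. (A2) $M=(M_{ij})\in C^0([0,1]^n;\mathbb{R}^{n\times n})$ is symmetric, positive semidefinite, and there are $0<c_M<C_M<\infty$ with $c_M|\Pi z|^2\le\sum_{i,j=1}^nM_{ij}(\mathbf{S})z_iz_j\le C_M|\Pi z|^2$ for all $z\in\mathbb{R}^n$, $\mathbf{S}\in\mathcal{D}$, where $\Pi=I-\frac1n\mathbf{1}\otimes\mathbf{1}$, $\mathbf{1}=(1,\ldots,1)$. **Mesh.** $(\mathcal{T},\mathcal{E},\mathcal{P})$ is an admissible mesh of $\Omega$ in the sense of Eymard, Gallouët and Herbin: $\mathcal{T}$ is a family of open polygonal convex cells $K\subset\Omega$, $\mathcal{E}$ the family of edges (faces), $\mathcal{P}=(x_K)_{K\in\mathcal{T}}$ a family of points associated to the cells, and the segment joining $x_K$ and $x_L$ of two neighboring cells is orthogonal to their common edge $\sigma=K|L$. $\mathcal{E}_K$ is the set of edges of $K$; $\mathcal{E}=\mathcal{E}_{\rm int}\cup\mathcal{E}_{\rm ext}$ (interior/boundary edges), $\mathcal{E}_{\rm ext}=\mathcal{E}_{\rm ext}^D\cup\mathcal{E}_{\rm ext}^N$ (edges on the Dirichlet, resp. Neumann boundary). $\mathrm{m}$ is Lebesgue measure ($d$- or $(d-1)$-dimensional). $\mathrm{d}_\sigma=|x_K-x_L|$ if $\sigma=K|L$, $\mathrm{d}_\sigma=\mathrm{dist}(x_K,\sigma)$ if $\sigma\in\mathcal{E}_{\rm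 ext}$; $\tau_\sigma=\mathrm{m}(\sigma)/\mathrm{d}_\sigma$. $\Delta t>0$ is the time step. $V_{\Delta x}^n$ is the space of $\mathbb{R}^n$-valued functions constant on each cell, $v=(v_K)_{K\in\mathcal{T}}$. For a cell quantity $v$ and $\sigma\in\mathcal{E}_K$: $\mathrm{D}_{K,\sigma}v=v_{K,\sigma}-v_K$, where $v_{K,\sigma}=v_L$ if $\sigma=K|L$; $v_{K,\sigma}=v_\sigma^D=\mathrm{m}(\sigma)^{-1}\int_\sigma v\,ds$ (mean of the boundary value) if $\sigma\in\mathcal{E}_{\rm ext}^D$; and $v_{K,\sigma}=v_K$ if $\sigma\in\mathcal{E}_{\rm ext}^N$. In particular, on Dirichlet edges $S_{i,K,\sigma}=S_{i,\sigma}^D=\mathrm{m}(\sigma)^{-1}\int_\sigma S_i^D\,ds$, and the boundary value of $\mu_i$ is $0$. In sums over $\sigma\in\mathcal{E}$, $K$ is a cell with $\sigma\in\mathcal{E}_K$. **Scheme quantities.** $S_{i,K}^0=\mathrm{m}(K)^{-1}\int_K S_i^0dx$, $\Phi_K=\mathrm{m}(K)^{-1}\int_K\Phi\,dx$, $S_K^k=\sum_iS_{i,K}^k$, $\boldsymbol{\mu}^k=(\mu_1^k,\ldots,\mu_n^k)$ with $S_{i,K}^k=S_i(\boldsymbol{\mu}_K^k)$, where $\boldsymbol\mu\mapsto\mathbf{S}(\boldsymbol\mu)\in\mathcal{D}$ is the inverse of $\mathbf{S}\mapsto\boldsymbol\mu$; $S_{i,\sigma}^k=\frac12(S_{i,K}^k+S_{i,K,\sigma}^k)$,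 $c_{i,K}^k=S_{i,K}^k/S_K^k$ (similarly $c_{i,K,\sigma}^k=S_{i,K,\sigma}^k/S_{K,\sigma}^k$), and $$a_\sigma^k=\frac{\beta(S_{K,\sigma}^k)-\beta(S_K^k)}{\psi(S_{K,\sigma}^k)-\psi(S_K^k)}$$ (understood as $a(S_K^k)$ if $S_{K,\sigma}^k=S_K^k$). With $\mathcal{N}_1=\{i:c_{i,K}^k\ne c_{i,K,\sigma}^k\}$, $\mathcal{N}_2=\{i:c_{i,K}^k=c_{i,K,\sigma}^k\}$ (depending on $\sigma,k$), put $c_{i,\sigma}^k=c_{i,K}^k$ for $i\in\mathcal{N}_2$ and, for $i\in\mathcal{N}_1$, $$c_{i,\sigma}^k=\frac1{m_\sigma^k}\frac{c_{i,K,\sigma}^k-c_{i,K}^k}{\log c_{i,K,\sigma}^k-\log c_{i,K}^k},\quad m_\sigma^k=\Big(1-\sum_{i\in\mathcal{N}_2}c_{i,K}^k\Big)^{-1}\sum_{i\in\mathcal{N}_1}\frac{c_{i,K,\sigma}^k-c_{i,K}^k}{\log c_{i,K,\sigma}^k-\log c_{i,K}^k}$$ ($m_\sigma^k$ is not needed if $\mathcal{N}_1=\emptyset$). **Discrete energy.** $H_d(\mathbf{S}^k)=\sum_{K\in\mathcal{T}}\mathrm{m}(K)\Phi_KE(\mathbf{S}_K^k)+\frac12\sum_{\sigma\in\mathcal{E}}\tau_\sigma|\mathrm{D}_{K,\sigma}\beta(S^k)|^2$.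
   Formalization: The Dirichlet data S_i^D are taken to be constants (positive, with sum less than 1): for data varying along the Dirichlet boundary E(S_K) is not defined, and a non-constant steady state violates the inequality. *)

(* Defs.v *)
From HB Require Import structures.
From mathcomp Require Import all_boot all_order all_algebra.
From mathcomp Require Import all_classical all_reals all_analysis.
Set Implicit Arguments.
Unset Strict Implicit.
Unset Printing Implicit Defensive.
Import Order.TTheory GRing.Theory Num.Theory.
Import numFieldNormedType.Exports.
Local Open Scope classical_set_scope.
Local Open Scope ring_scope.

(* The Borel sigma-algebra of R^n, generated by the coordinates. *)
Section measurable_rV.
Context (R : realType) (n : nat).

Let coord (i : 'I_n) (x : 'rV[R]_n) : R := x ord0 i.

Let rV_set0 : g_sigma_preimage coord set0.
Proof. exact: sigma_algebra0. Qed.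

Let rV_setC A : g_sigma_preimage coord A -> g_sigma_preimage coord (~` A).
Proof. exact: sigma_algebraC. Qed.

Let rV_bigcup (F : _^nat) : (forall i, g_sigma_preimage coord (F i)) ->
  g_sigma_preimage coord (\bigcup_i (F i)).
Proof. exact: sigma_algebra_bigcup. Qed.

HB.instance Definition _ := @isMeasurable.Build default_measure_display
  'rV[R]_n (g_sigma_preimage coord) rV_set0 rV_setC rV_bigcup.

End measurable_rV.

Lemma measurable_fun_rV d (T : measurableType d) (R : realType) n
    (f : T -> 'rV[R]_n) :
  (forall i, measurable_fun [set: T] (fun t => f t ord0 i : R)) ->
  measurable_fun [set: T] f.
Proof.
move=> mf _ Y mY; rewrite setTI; move: Y mY.
suff : measurable `<=` [set Y : set 'rV[R]_n | measurable (f @^-1` Y)] by apply.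
apply: smallest_sub.
  split=> /=; first by rewrite preimage_set0.
    by move=> A mA; rewrite setTD preimage_setC; exact: measurableC.
  by move=> F mF; rewrite preimage_bigcup; exact: bigcupT_measurable.
move=> A; rewrite -bigcup_seq => -[i _] [B mB <-] /=.
by rewrite setTI; have := mf i measurableT B mB; rewrite setTI.
Qed.

Lemma measurable_coord (R : realType) n (i : 'I_n) :
  measurable_fun [set: 'rV[R]_n] (fun x : 'rV[R]_n => x ord0 i : R).
Proof.
move=> _ Y mY; rewrite setTI; apply: sub_sigma_algebra.
rewrite -bigcup_seq; exists i; first by rewrite /= mem_index_enum.
by exists Y => //; rewrite setTI.
Qed.

(* The identification of R x R^n with R^(n+1). *)
Definition consrV (R : realType) n (p : R * 'rV[R]_n) : 'rV[R]_n.+1 :=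
  row_mx p.1%:M p.2.

Lemma measurable_consrV (R : realType) n :
  measurable_fun [set: R * 'rV[R]_n] (@consrV R n).
Proof.
apply: measurable_fun_rV => i.
have [j ->|j ->] := split_ordP (i : 'I_(1 + n)).
  rewrite (_ : (fun _ => _) = fst); first exact: measurable_fst.
  by apply/funext => p; rewrite /consrV [LHS](@row_mxEl _ 1 1 n) [j]ord1 mxE eqxx mulr1n.
rewrite (_ : (fun _ => _) = (fun x : 'rV[R]_n => x ord0 j) \o snd).
  by apply: measurableT_comp; [exact: measurable_coord|exact: measurable_snd].
by apply/funext => p; rewrite /consrV [LHS](@row_mxEr _ 1 1 n).
Qed.

(* Lebesgue measure on R^n, as the iterated product of the one-dimensional one;
   for n = 0 it is the unit mass at the only point. *)
Fixpoint lebesgue_rV (R : realType) (n : nat) : set 'rV[R]_n -> \bar R :=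
  match n with
  | 0 => \d_(0 : 'rV[R]_0)
  | n'.+1 =>
      pushforward (lebesgue_measure \x lebesgue_rV (R := R) (n := n'))%E
        (@consrV R n')
  end.
Arguments lebesgue_rV R n : clear implicits.


Definition cube (R : realType) n (k : nat) : set 'rV[R]_n :=
  [set x | forall i, `|x ord0 i| <= k%:R].

Lemma measurable_cube (R : realType) n k : measurable (@cube R n k).
Proof.
rewrite (_ : cube k = \bigcap_(i in [set: 'I_n])
    ((fun x : 'rV[R]_n => x ord0 i) @^-1` `[- k%:R, k%:R])).
  apply: fin_bigcap_measurable => // i _.
  by rewrite -[X in measurable X]setTI; exact: measurable_coord.
apply/seteqP; split=> x /=.
  by move=> xk i _; rewrite /= in_itv/= -ler_norml.
by move=> xk i; have := xk i I; rewrite /= in_itv/= -ler_norml.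
Qed.

Lemma consrV_cube (R : realType) n k :
  @consrV R n @^-1` cube k = `[- k%:R, k%:R] `*` @cube R n k.
Proof.
have c0 (p : R * 'rV[R]_n) (j : 'I_1) : consrV p ord0 (@lshift 1 n j) = p.1.
  by rewrite /consrV (@row_mxEl _ 1 1 n) [j]ord1 mxE eqxx mulr1n.
have cS (p : R * 'rV[R]_n) (j : 'I_n) : consrV p ord0 (@rshift 1 n j) = p.2 ord0 j.
  by rewrite /consrV (@row_mxEr _ 1 1 n).
apply/seteqP; split=> p /=.
  move=> pk; split=> [|j]; rewrite /= ?in_itv/= -?ler_norml.
    by have := pk (lshift n (@ord0 0)); rewrite c0.
  by have := pk (@rshift 1 n j); rewrite cS.
move=> [] /=; rewrite in_itv/= -ler_norml => p1 p2 i.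
by have [j ->|j ->] := split_ordP (i : 'I_(1 + n)); rewrite ?c0 ?cS.
Qed.

Lemma cube_sigma_finite (R : realType) n (mu : set 'rV[R]_n -> \bar R) :
  (forall k, mu (cube k) < +oo)%E -> sigma_finite setT mu.
Proof.
move=> muk; exists (@cube R n); last by move=> k; split; [exact: measurable_cube|].
apply/seteqP; split=> // x _; exists (Num.truncn `|x|).+1 => // i.
have /ltW := @truncnS_gt R `|x|; apply: le_trans.
rewrite [leRHS]/Num.norm/= mx_normrE.
exact: (le_bigmax _ (fun ij => `|x ij.1 ij.2|) (ord0, i)).
Qed.

Lemma lebesgue_rV_sigma_finite_measure (R : realType) n :
  exists2 mu : {sigma_finite_measure set 'rV[R]_n -> \bar R},
    mu = lebesgue_rV R n :> (set 'rV[R]_n -> \bar R) &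
    forall k, (mu (cube k) < +oo)%E.
Proof.
elim: n => [|n [mu muE muk]].
  exists (\d_(0 : 'rV[R]_0)) => // k.
  by rewrite (le_lt_trans (probability_le1 _ _))// ?ltry//; exact: measurable_cube.
have mc := @measurable_consrV R n.
pose nu : {measure set 'rV[R]_n.+1 -> \bar R} :=
   measure_function_pushforward__canonical__measure_function_Measure
    (lebesgue_measure \x mu)%E mc.
have nuk k : (nu (cube k) < +oo)%E.
  rewrite /nu/= /pushforward consrV_cube product_measure1E//; last first.
    exact: measurable_cube.
  by rewrite lte_mul_pinfty//= lebesgue_measure_itv/=; case: ifP; rewrite ?ltry.
pose nuf : set 'rV[R]_n.+1 -> \bar R := nu.
pose ms := isMeasure.Build _ _ _ nuf (measure0 nu) (measure_ge0 nu)
  (@measure_semi_sigma_additive _ _ _ nu).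
pose sf := isSigmaFinite.Build _ _ _ nuf (cube_sigma_finite nuk).
pose sfs := isSFinite.Build _ _ _ nuf
  (sfinite_measure_sigma_finite (cube_sigma_finite nuk)).
pose nu' : {sigma_finite_measure set 'rV[R]_n.+1 -> \bar R} :=
  HB.pack nuf ms sf sfs.
by exists nu' => //=; rewrite /nuf/= muE.
Qed.

Section lebesgue_rV_measure.
Context (R : realType) (n : nat).

Let lebesgue_rV0 : lebesgue_rV R n set0 = 0%E.
Proof.
by have [mu <- _] := lebesgue_rV_sigma_finite_measure R n; exact: measure0.
Qed.

Let lebesgue_rV_ge0 A : (0 <= lebesgue_rV R n A)%E.
Proof.
by have [mu <- _] := lebesgue_rV_sigma_finite_measure R n; exact: measure_ge0.
Qed.

Let lebesgue_rV_sigma_additive : semi_sigma_additive (lebesgue_rV R n).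
Proof.
have [mu <- _] := lebesgue_rV_sigma_finite_measure R n.
exact: measure_semi_sigma_additive.
Qed.

HB.instance Definition _ := isMeasure.Build _ _ _ (lebesgue_rV R n)
  lebesgue_rV0 lebesgue_rV_ge0 lebesgue_rV_sigma_additive.

Let lebesgue_rV_sigma_finite : sigma_finite setT (lebesgue_rV R n).
Proof.
by have [mu <- _] := lebesgue_rV_sigma_finite_measure R n; exact: sigma_finiteT.
Qed.

HB.instance Definition _ := Measure_isSigmaFinite.Build _ _ _
  (lebesgue_rV R n) lebesgue_rV_sigma_finite.

End lebesgue_rV_measure.

Section geometry.
Context (R : realType) (d : nat).
Implicit Types (A : set 'rV[R]_d) (x y : 'rV[R]_d).

Definition dotv x y : R := \sum_i x ord0 i * y ord0 i.

(* The library norm on 'rV[R]_d is the sup norm, hence this definition. *)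
Definition enorm x : R := Num.sqrt (dotv x x).

Definition edist x A : R := inf [set enorm (x - y) | y in A].

Definition bdry A : set 'rV[R]_d := closure A `\` interior A.

(* (d-1)-dimensional measure.  The maps u |-> p + u *m U with U *m U^T = 1 are
   the affine isometric embeddings of R^(d-1) in R^d.  If A lies in a hyperplane
   H, an embedding onto H gives the (d-1)-dimensional Lebesgue measure of A, and
   any other one meets A in a set of measure 0; so the supremum is that measure.
   If A lies in a finite union of hyperplanes, the supremum is positive exactly
   when the (d-1)-dimensional measure of A is. *)
Definition surface_measure A : \bar R :=
  ereal_sup [set r | exists (p : 'rV[R]_d) (U : 'M[R]_(d.-1, d)),
    U *m U^T = 1%:M /\
    r = lebesgue_rV R d.-1 [set u | A (p + u *m U)]].

Definition open_polytope A : Prop :=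
  exists (m : nat) (N : 'M[R]_(d, m)) (c : 'rV[R]_m),
    A = [set x | forall j, (x *m N) ord0 j < c ord0 j].

Definition orthogonal_to x A : Prop :=
  forall y z, A y -> A z -> dotv x (y - z) = 0.

Fixpoint Ck (k : nat) (f : 'rV[R]_d -> R) : Prop :=
  continuous f /\
  match k with
  | 0 => True
  | k'.+1 => forall j : 'I_d,
      (forall x, derivable f x (delta_mx ord0 j)) /\
      Ck k' (fun x => 'D_(delta_mx ord0 j) f x)
  end.

Definition test_function A (f : 'rV[R]_d -> R) : Prop :=
  [/\ forall k, Ck k f,
      compact (closure [set x | f x != 0]) &
      closure [set x | f x != 0] `<=` A].

Definition locally_integrable A (f : 'rV[R]_d -> R) : Prop :=
  forall C, compact C -> C `<=` A ->
    (lebesgue_rV R d).-integrable C (EFin \o f).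

Definition weak_gradient A (u : 'rV[R]_d -> R) (G : 'rV[R]_d -> 'rV[R]_d) :
    Prop :=
  [/\ locally_integrable A u,
      measurable_fun A G,
      forall j, locally_integrable A (fun x => G x ord0 j) &
      forall f j, test_function A f ->
        \int[lebesgue_rV R d]_(x in A) (u x * 'D_(delta_mx ord0 j) f x) =
        - \int[lebesgue_rV R d]_(x in A) (G x ord0 j * f x)].

Record fv_domain := FVDomain {
  Omega : set 'rV[R]_d;
  GammaD : set 'rV[R]_d;
  GammaN : set 'rV[R]_d;
  Omega_neq0 : Omega !=set0;
  Omega_open : open Omega;
  Omega_connected : connected Omega;
  Omega_bounded : bounded_set Omega;
  bdry_Omega : bdry Omega = GammaD `|` GammaN;
  GammaDN0 : GammaD `&` GammaN = set0;
  GammaD_gt0 : (0 < surface_measure GammaD)%E;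
  GammaN_open : exists2 U, open U & GammaN = U `&` bdry Omega }.

(* Admissible mesh in the sense of Eymard, Gallouet and Herbin.  [edges_of K] is
   E_K.  An edge is exterior when it is contained in the boundary of Omega, and
   interior otherwise.  [mesh_int] says that an interior edge s is s = K|L for
   exactly one pair of cells, [mesh_ext] that an exterior edge belongs to one
   cell and lies either on the Dirichlet or on the Neumann part. *)
Record admissible_mesh (D : fv_domain) := AdmissibleMesh {
  cell : finType;
  edge : finType;
  cell_set : cell -> set 'rV[R]_d;
  edge_set : edge -> set 'rV[R]_d;
  node : cell -> 'rV[R]_d;
  edges_of : cell -> {set edge};
  cell_polytope : forall K, open_polytope (cell_set K);
  cell_neq0 : forall K, cell_set K !=set0;
  cell_sub : forall K, cell_set K `<=` Omega D;
  edge_hyperplane : forall s, exists (v : 'rV[R]_d) (c : R),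
    v != 0 /\ edge_set s `<=` [set x | dotv v x = c];
  edge_measurable : forall s, measurable (edge_set s);
  edge_gt0 : forall s, (0 < surface_measure (edge_set s))%E;
  edge_sub : forall s, edge_set s `<=` closure (Omega D);
  mesh_cover : closure (\bigcup_K cell_set K) = closure (Omega D);
  mesh_bdry : forall K, closure (cell_set K) `\` cell_set K =
    \bigcup_(s in [set s | s \in edges_of K]) closure (edge_set s);
  mesh_interface : forall K L, K != L ->
    surface_measure (closure (cell_set K) `&` closure (cell_set L)) = 0%E \/
    exists s, [/\ s \in edges_of K, s \in edges_of L &
      closure (cell_set K) `&` closure (cell_set L) = closure (edge_set s)];
  mesh_node : forall K, closure (cell_set K) (node K);
  mesh_int : forall s, ~ (edge_set s `<=` bdry (Omega D)) -> exists K L,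
    [/\ K != L,
        forall J, (s \in edges_of J) = (J == K) || (J == L),
        closure (cell_set K) `&` closure (cell_set L) = closure (edge_set s),
        node K != node L &
        orthogonal_to (node L - node K) (edge_set s)];
  mesh_ext : forall s, edge_set s `<=` bdry (Omega D) -> exists K,
    [/\ forall J, (s \in edges_of J) = (J == K),
        ~ edge_set s (node K) -> exists2 y, edge_set s y &
          orthogonal_to (y - node K) (edge_set s) &
        edge_set s `<=` GammaD D \/ edge_set s `<=` GammaN D] }.

End geometry.

Section mesh_operators.
Context (R : realType) (d : nat) (D : fv_domain R d) (T : admissible_mesh D).
Implicit Types (K : cell T) (s : edge T).

Definition cell_measure K : R := fine (lebesgue_rV R d (cell_set K)).

Definition cell_mean K (f : 'rV[R]_d -> R) : R :=
  (cell_measure K)^-1 * \int[lebesgue_rV R d]_(x in cell_set K) f x.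

(* For s in E_K: [Some L] if s = K|L, and [None] if s is exterior. *)
Definition neighbor K s : option (cell T) :=
  [pick L | (L != K) && (s \in edges_of L)].

Definition dirichlet_edge s : bool := `[< edge_set s `<=` GammaD D >].

Definition edge_dist K s : R :=
  if neighbor K s is Some L then enorm (node K - node L)
  else edist (node K) (edge_set s).

Definition transmissibility K s : R :=
  fine (surface_measure (edge_set s)) / edge_dist K s.

(* v_{K,s}; the Dirichlet value vD is a constant, so it is its own mean on s. *)
Definition edge_value (V : Type) (vD : V) (v : cell T -> V) K s : V :=
  if neighbor K s is Some L then v L
  else if dirichlet_edge s then vD else v K.

Definition jump (V : zmodType) (vD : V) (v : cell T -> V) K s : V :=
  edge_value vD v K s - v K.

End mesh_operators.

Definition oriented_integral (R : realType) (f : R -> R) (x y : R) : R :=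
  if x <= y then \int[lebesgue_measure]_(t in `[x, y]) f t
  else - \int[lebesgue_measure]_(t in `[y, x]) f t.

(* The entropy density depends on the Dirichlet data but not on the space
   variable, so the Dirichlet data are a constant vector.  The fields are a, b,
   beta (with beta' = b), P_c, the matrix M and S^D, in this order. *)
Record model (R : realType) (n : nat) := Model {
  diff_mob : R -> R;
  dyn_cap : R -> R;
  beta : R -> R;
  Pc : R -> R;
  cross_diff : 'rV[R]_n -> 'M[R]_n;
  satD : 'rV[R]_n }.

Section model.
Context (R : realType) (n : nat).
Implicit Types (P : model R n) (S z : 'rV[R]_n).

Definition tot S : R := \sum_i S ord0 i.

Definition sat_domain : set 'rV[R]_n :=
  [set S : 'rV[R]_n | (forall i, 0 < S ord0 i) /\ tot S < 1].

Definition psi P (t : R) : R :=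
  oriented_integral (fun y => dyn_cap P y / diff_mob P y) (tot (satD P)) t.

Definition Psi P (t : R) : R := oriented_integral (psi P) (tot (satD P)) t.

Definition entropy P S : R :=
  \sum_i S ord0 i * ln (S ord0 i / satD P ord0 i)
  - tot S * ln (tot S / tot (satD P)) + Psi P (tot S).

Definition chem_pot P S : 'rV[R]_n :=
  \row_i (ln (S ord0 i / tot S) - ln (satD P ord0 i / tot (satD P))
          + psi P (tot S)).

(* Local integrability of b / a on (0,1) is what psi needs to be defined. *)
Definition model_assumptions P : Prop :=
  [/\ forall t, 0 < t < 1 -> 0 < diff_mob P t /\ 0 < dyn_cap P t,
      forall t : R, 0 < t < 1 -> is_derive t 1 (beta P) (dyn_cap P t),
      forall x y : R, 0 < x -> x <= y -> y < 1 ->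
        beta P x <= beta P y /\ Pc P x <= Pc P y,
      forall x y : R, 0 < x -> x <= y -> y < 1 ->
        lebesgue_measure.-integrable `[x, y]
          (EFin \o (fun t => dyn_cap P t / diff_mob P t)) &
      sat_domain (satD P)].

(* The matrix I - (1/n) 1 (x) 1 is symmetric, so it may act on row vectors. *)
Definition Proj : 'M[R]_n := 1%:M - n%:R^-1 *: const_mx 1.

Definition quad_form (A : 'M[R]_n) z : R :=
  \sum_i \sum_j A i j * z ord0 i * z ord0 j.

Definition assumption_A2 P (cM CM : R) : Prop :=
  let cube01 := [set S : 'rV[R]_n | forall i, 0 <= S ord0 i <= 1] in
  [/\ {within cube01, continuous (cross_diff P)},
      forall S : 'rV[R]_n, cube01 S -> (cross_diff P S)^T = cross_diff P S,
      forall S z : 'rV[R]_n, cube01 S -> 0 <= quad_form (cross_diff P S) z,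
      0 < cM < CM &
      forall S z : 'rV[R]_n, sat_domain S ->
        cM * dotv (z *m Proj) (z *m Proj) <= quad_form (cross_diff P S) z
          <= CM * dotv (z *m Proj) (z *m Proj)].

Definition assumption_A1 d (D : fv_domain R d) P (Phi : 'rV[R]_d -> R)
    (S0 : 'rV[R]_d -> 'rV[R]_n) : Prop :=
  [/\ (lebesgue_rV R d).-integrable (Omega D) (EFin \o Phi),
      forall x, Omega D x -> 0 <= Phi x <= 1,
      exists2 cPhi, 0 < cPhi & forall x, Omega D x -> cPhi <= Phi x,
      measurable_fun (Omega D) S0 /\
      (exists2 G, weak_gradient (Omega D) (fun x => beta P (tot (S0 x))) G &
        \int[lebesgue_rV R d]_(x in Omega D)
          (Phi x * entropy P (S0 x) + 2^-1 * dotv (G x) (G x))%:E < +oo)%E &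
      exists2 c, 0 < c < 1 & forall x, Omega D x ->
        (forall i, c <= S0 x ord0 i) /\ tot (S0 x) <= 1 - c].

End model.
Arguments Proj {R} n.

Section scheme.
Context (R : realType) (d n : nat) (D : fv_domain R d) (T : admissible_mesh D).
Context (P : model R n) (Phi : 'rV[R]_d -> R) (dt : R).
Implicit Types (S : cell T -> 'rV[R]_n) (K : cell T) (s : edge T) (i : 'I_n).

Definition edge_sat S K s : 'rV[R]_n := edge_value (satD P) S K s.

Definition jump_tot (f : R -> R) S K s : R :=
  jump (f (tot (satD P))) (fun L => f (tot (S L))) K s.

Definition jump_chem S K s : 'rV[R]_n :=
  jump 0 (fun L => chem_pot P (S L)) K s.

Definition conc (S1 : 'rV[R]_n) i : R := S1 ord0 i / tot S1.

Definition conc_diff_set S K s : {set 'I_n} :=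
  [set i | conc (S K) i != conc (edge_sat S K s) i].

Definition log_mean (x y : R) : R := (y - x) / (ln y - ln x).

Definition edge_m S K s : R :=
  (1 - \sum_(i in ~: conc_diff_set S K s) conc (S K) i)^-1 *
  \sum_(i in conc_diff_set S K s)
    log_mean (conc (S K) i) (conc (edge_sat S K s) i).

Definition edge_conc S K s i : R :=
  if i \in conc_diff_set S K s
  then (edge_m S K s)^-1 * log_mean (conc (S K) i) (conc (edge_sat S K s) i)
  else conc (S K) i.

Definition edge_mob S K s : R :=
  let t := tot (S K) in
  let u := tot (edge_sat S K s) in
  if u == t then diff_mob P t else (beta P u - beta P t) / (psi P u - psi P t).

(* F_{i,K,s}(S), where S' is the solution at the previous time step.  The jump in
   the first term is that of Pc(S) + (beta(S) - beta(S')) / dt, whose Dirichlet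
   value is Pc(S^D) + (beta(S^D) - beta(S^D)) / dt. *)
Definition flux S' S K s i : R :=
  - transmissibility K s * edge_conc S K s i * edge_mob S K s *
    jump (Pc P (tot (satD P))
          + (beta P (tot (satD P)) - beta P (tot (satD P))) / dt)
      (fun L => Pc P (tot (S L)) + (beta P (tot (S L)) - beta P (tot (S' L))) / dt)
      K s
  - transmissibility K s *
    \sum_j cross_diff P (2^-1 *: (S K + edge_sat S K s)) i j *
      jump_chem S K s ord0 j.

Definition scheme_step S' S : Prop := forall K i,
  cell_measure K / dt * cell_mean K Phi * (S K ord0 i - S' K ord0 i)
  + \sum_(s in edges_of K) flux S' S K s i = 0.

(* [rep s] is the cell K chosen for the edge s in sums over all edges. *)
Definition discrete_energy (rep : edge T -> cell T) S : R :=
  \sum_K cell_measure K * cell_mean K Phi * entropy P (S K)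
  + 2^-1 * \sum_s transmissibility (rep s) s *
      `|jump_tot (beta P) S (rep s) s| ^+ 2.

End scheme.

(* Main.v *)
Require Import Defs.
From mathcomp Require Import all_boot all_order all_algebra.
From mathcomp Require Import all_classical all_reals all_analysis.
From mathcomp Require Import measurable_realfun ring lra.
Set Implicit Arguments.
Unset Strict Implicit.
Unset Printing Implicit Defensive.
Import Order.TTheory GRing.Theory Num.Theory.
Import numFieldNormedType.Exports.
Local Open Scope classical_set_scope.
Local Open Scope ring_scope.

(** The chemical potential is the gradient of the entropy density [E], and [E]
    is convex.  Testing the scheme with [dt * mu_i] and summing over cells and
    components therefore bounds the increase of the entropy part of the energy
    by [dt] times a sum over edges of [flux * jump mu] ([entropy_gradient],
    [summed_scheme]): the flux through a shared edge changes sign with the cell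
    it is seen from ([fluxC]), so the cell sum can be summed by parts
    ([sum_by_parts]), and there is no boundary term because [mu] vanishes on
    Dirichlet edges and the flux vanishes on Neumann edges.

    The averages on the edges are chosen so that a discrete chain rule holds on
    each edge.  The logarithmic means make the weights [c_{i,s}] sum to [1] and
    be orthogonal to the jumps of [log c_i], whence
    [sum_i c_{i,s} * jump mu_i = jump psi] ([sum_edge_conc_jump]); and the mean
    mobility turns this into [a_s * jump psi = jump beta] ([edge_mob_psi]), where
    strict monotonicity of [psi] keeps the quotient [a_s] meaningful.  So,
    up to the transmissibility and with the opposite sign, the product of flux
    and [jump mu] on an edge consists of the static capillary
    term, of [jump beta * (jump beta - jump beta') / dt], which is at least
    [((jump beta)^2 - (jump beta')^2) / (2 * dt)] and yields the gradient part of
    the energy, and of the quadratic form of [M], bounded below by coercivity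
    ([edge_dissipation]).

    As [b / a] is only positive and locally integrable, [E] has no Hessian to
    inspect.  The convexity of its logarithmic part is the Gibbs inequality, and
    that of [Psi] holds because [Psi] is a primitive of the nondecreasing function
    [psi] ([gibbs_inequality], [Psi_gradient]).  The gradient inequality also
    needs the previous iterate to lie in the domain of [E].  At the first step
    this iterate is the vector of the cell means of the initial data
    ([cell_mean_sat_domain]); a cell of measure zero contributes nothing to the
    energy, so nothing is required there. *)

(** * Oriented integrals *)

Section oriented_integral.
Context {R : realType} (l u : R).
Local Notation leb := (@lebesgue_measure R).

Definition locally_integrable_itv (f : R -> R) : Prop :=
  forall x y : R, l < x -> x <= y -> y < u ->
    leb.-integrable `[x, y] (EFin \o f).

Lemma oriented_integral_le (f : R -> R) (x y : R) : x <= y ->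
  oriented_integral f x y = \int[leb]_(t in `[x, y]) f t.
Proof. by rewrite /oriented_integral => ->. Qed.

Lemma oriented_integralxx (f : R -> R) (x : R) : oriented_integral f x x = 0.
Proof. by rewrite oriented_integral_le// set_itv1 Rintegral_set1. Qed.

Lemma oriented_integralC (f : R -> R) (x y : R) :
  oriented_integral f y x = - oriented_integral f x y.
Proof.
have [xy|yx|->] := ltgtP x y; last by rewrite oriented_integralxx oppr0.
  by rewrite /oriented_integral (ltW xy) leNgt xy.
by rewrite /oriented_integral (ltW yx) leNgt yx opprK.
Qed.

(** Splitting one interval settles the case of increasing endpoints; the other
    orders follow by antisymmetry. *)
Lemma oriented_integralD (f : R -> R) (x y z : R) : locally_integrable_itv f ->
  l < x < u -> l < y < u -> l < z < u ->
  oriented_integral f x z = oriented_integral f x y + oriented_integral f y z.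
Proof.
move=> fI /andP[lx xu] /andP[ly yu] /andP[lz zu].
have chasles (a b c : R) : l < a -> c < u -> a <= b -> b <= c ->
    oriented_integral f a c = oriented_integral f a b + oriented_integral f b c.
  move=> la cu ab bc; have ac := le_trans ab bc.
  rewrite !oriented_integral_le//; apply/eqP; rewrite addrC -subr_eq; apply/eqP.
  rewrite Rintegral_itvB ?bnd_simp//; last exact: fI.
  rewrite Rintegral_itv_obnd_cbnd//.
  apply: (integrableS _ _ _ (fI a c _ _ _)) => //.
  by apply: subset_itvr; rewrite bnd_simp.
have C := oriented_integralC f.
have [xy|/ltW yx] := leP x y; have [yz|/ltW zy] := leP y z;
  have [xz|/ltW zx] := leP x z.
- by rewrite (chasles x y z).
- have [-> ->] : x = y /\ z = y by clear -xy yz zx; split; lra.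
  by rewrite oriented_integralxx addr0.
- by rewrite (chasles x z y)// (C y z) subrK.
- by rewrite (C z x) (C z y) (chasles z x y)// opprD addrCA subrr addr0.
- by rewrite (chasles y x z)// (C y x) addKr.
- by rewrite (C z x) (C y x) (chasles y z x)// opprD addrC addrA subrr add0r.
- have [-> ->] : x = y /\ z = y by clear -yx zy xz; split; lra.
  by rewrite oriented_integralxx addr0.
- by rewrite (C z x) (chasles z y x)// (C y x) (C z y) opprD addrC.
Qed.

(** If the integral vanished, [f] would vanish almost everywhere on an interval of
    positive length. *)
Lemma oriented_integral_gt0 (f : R -> R) (x y : R) : locally_integrable_itv f ->
  (forall t, l < t < u -> 0 < f t) -> l < x -> x < y -> y < u ->
  0 < oriented_integral f x y.
Proof.
move=> fI f0 lx xy yu; rewrite oriented_integral_le ?(ltW xy)//.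
have f0' t : `[x, y]%classic t -> 0 < f t.
  by rewrite /= in_itv/= => /andP[xt ty]; apply: f0; lra.
have xyI : leb.-integrable `[x, y] (EFin \o f) by exact: fI (ltW xy) yu.
rewrite lt_neqAle Rintegral_ge0 ?andbT; last by move=> t /f0' /ltW.
apply/eqP => /esym int0.
have : (\int[leb]_(t in `[x, y]) `|(f t)%:E| = 0)%E.
  transitivity (\int[leb]_(t in `[x, y]) (f t)%:E)%E.
    by apply: eq_integral => t; rewrite inE => /f0' ft; rewrite /= gtr0_norm.
  rewrite -[LHS]fineK; first by congr EFin.
  exact: integrable_fin_num.
move=> /ae_eq_integral_abs[]//.
  exact: (measurable_int leb).
move=> N [mN N0 fN].
have xyN : `[x, y] `<=` N.
  by move=> t xyt; apply: fN => /= /(_ xyt)[] ft; have := f0' _ xyt; rewrite ft ltxx.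
have : (leb `[x, y] <= leb N)%E by apply: le_measure; rewrite ?inE.
rewrite N0 lebesgue_measure_itv/= lte_fin xy -EFinD lee_fin; lra.
Qed.

(** Clamping the argument between [x] and [y] extends the restriction of [g] to a
    function that is nondecreasing on the whole line, hence measurable; on the
    interval it is bounded by the values at the endpoints. *)
Lemma nondecreasing_locally_integrable (g : R -> R) :
  (forall s t, l < s -> s <= t -> t < u -> g s <= g t) ->
  locally_integrable_itv g.
Proof.
move=> gnd x y lx xy yu.
pose h t := g (Num.max x (Num.min t y)).
have hb t : x <= Num.max x (Num.min t y) <= y.
  by rewrite le_max lexx/= ge_max xy ge_min lexx orbT.
have hnd : nondecreasing_fun h.
  move=> s t st; apply: gnd.
  - by have /andP[] := hb s; lra.
  - rewrite ge_max le_max lexx/= le_max; apply/orP; right.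
    by rewrite le_min ge_min st/= ge_min lexx orbT.
  - by have /andP[] := hb t; lra.
have hg : {in `[x, y], g =1 h}.
  move=> t; rewrite in_itv/= => /andP[xt ty]; rewrite /h min_l// max_r//.
apply: measurable_bounded_integrable => //.
- by rewrite /= lebesgue_measure_itv/=; case: ifP; rewrite -?EFinD ltry.
- apply: (eq_measurable_fun h); last exact: nondecreasing_measurable.
  by move=> t; rewrite inE => xyt; rewrite hg.
- exists (`|g x| + `|g y|); split => // M gM t /=; rewrite in_itv/= => /andP[xt ty].
  apply/ltW/(le_lt_trans _ gM).
  have g1 : g x <= g t by apply: gnd; lra.
  have g2 : g t <= g y by apply: gnd; lra.
  rewrite ler_norml; have := ler_norm (g y); have := ler_norm (- g x).
  by rewrite normrN; have := normr_ge0 (g x); have := normr_ge0 (g y); lra.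
Qed.

(** The tangent inequality of a convex function, for a primitive of a monotone
    function that need not be continuous.  Both orders of [s] and [t] compare [g]
    with the constant [g t]. *)
Lemma oriented_integral_nondecreasing_le (g : R -> R) (s t : R) :
  (forall s t, l < s -> s <= t -> t < u -> g s <= g t) ->
  l < s < u -> l < t < u -> oriented_integral g s t <= g t * (t - s).
Proof.
move=> gnd /andP[ls su] /andP[lt tu].
have gI := nondecreasing_locally_integrable gnd.
have cI x y : x <= y -> leb.-integrable `[x, y] (EFin \o cst (g t)).
  move=> xy; apply: measurable_bounded_integrable => //.
    by rewrite /= lebesgue_measure_itv/=; case: ifP; rewrite -?EFinD ltry.
  by exists `|g t|; split => // M gM z _; exact: ltW.
have cE x y : x <= y -> \int[leb]_(z in `[x, y]) (g t) = g t * (y - x).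
  move=> xy; rewrite Rintegral_cst//= lebesgue_measure_itv/= lte_fin.
  case: ltP => [_|yx] /=; first by rewrite -?EFinD.
  have <- : x = y by apply/le_anti; rewrite xy yx.
  by rewrite subrr.
have [st|/ltW ts] := leP s t.
  rewrite oriented_integral_le// -cE//; apply: le_Rintegral => //.
  - exact: gI.
  - exact: cI.
  - by move=> z /=; rewrite in_itv/= => /andP[sz zt]; apply: gnd; lra.
rewrite oriented_integralC oriented_integral_le// -opprB mulrN lerN2 -cE//.
apply: le_Rintegral => //; [exact: cI|exact: gI|].
by move=> z /=; rewrite in_itv/= => /andP[tz zs]; apply: gnd; lra.
Qed.

End oriented_integral.

(** * Convexity of the entropy density *)

Section saturations.
Context {R : realType} {n : nat} (n_gt0 : (0 < n)%N).
Implicit Types S : 'rV[R]_n.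

Lemma tot_gt0 S : (forall i, 0 < S ord0 i) -> 0 < tot S.
Proof.
move=> S0; rewrite /tot (bigD1 (Ordinal n_gt0))//= ltr_pwDl ?S0//.
by apply: sumr_ge0 => i _; exact: ltW.
Qed.

Lemma sat_domain_tot S : sat_domain S -> 0 < tot S < 1.
Proof. by move=> [S0 S1]; rewrite tot_gt0. Qed.

Lemma conc_gt0 S i : sat_domain S -> 0 < conc S i.
Proof. by move=> SD; have [S0 _] := SD; rewrite divr_gt0// tot_gt0. Qed.

Lemma sum_conc S : sat_domain S -> \sum_i conc S i = 1.
Proof.
by move=> /sat_domain_tot/andP[s0 _]; rewrite -mulr_suml divff// gt_eqF.
Qed.

Lemma sat_domain_mid S S' : sat_domain S -> sat_domain S' ->
  sat_domain (2^-1 *: (S + S')).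
Proof.
move=> [S0 S1] [S0' S1']; split=> [i|].
  by rewrite !mxE mulr_gt0// ?addr_gt0// invr_gt0.
have -> : tot (2^-1 *: (S + S')) = 2^-1 * (tot S + tot S').
  rewrite /tot -big_split mulr_sumr; apply: eq_bigr => i _; by rewrite !mxE.
lra.
Qed.

End saturations.

(** Termwise this is [ln x <= x - 1] at [x = q i / p i]. *)
Lemma gibbs_inequality (R : realType) (I : finType) (p q : I -> R) :
  (forall i, 0 < p i) -> (forall i, 0 < q i) -> \sum_i p i = \sum_i q i ->
  \sum_i p i * (ln (q i) - ln (p i)) <= 0.
Proof.
move=> p0 q0 pq; apply: (@le_trans _ _ (\sum_i (q i - p i))); last first.
  by rewrite sumrB pq subrr.
apply: ler_sum => i _; rewrite -ln_div ?posrE//.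
have -> : q i - p i = p i * (q i / p i - 1).
  by rewrite mulrBr mulr1 mulrC divfK// gt_eqF.
rewrite ler_pM2l//; have qp0 : 0 < q i / p i by rewrite divr_gt0.
have := @le_ln1Dx R (q i / p i - 1); rewrite addrCA subrr addr0; apply; lra.
Qed.

Section entropy.
Context {R : realType} {n : nat} (n_gt0 : (0 < n)%N) (P : model R n).
Hypothesis PA : model_assumptions P.
Implicit Types S : 'rV[R]_n.
Local Notation sD := (tot (satD P)).

Lemma satD_domain : sat_domain (satD P).
Proof. by case: PA. Qed.

Let f (y : R) := dyn_cap P y / diff_mob P y.

Let fI : locally_integrable_itv 0 1 f.
Proof. by case: PA. Qed.

Let sD01 : 0 < sD < 1.
Proof. exact/sat_domain_tot/satD_domain. Qed.

Lemma psiB (s t : R) : 0 < s < 1 -> 0 < t < 1 ->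
  psi P t - psi P s = oriented_integral f s t.
Proof.
move=> s01 t01; rewrite /psi (@oriented_integralD _ _ _ f sD s t fI)//.
by rewrite addrC addKr.
Qed.

Lemma psi_increasing (s t : R) : 0 < s -> s < t -> t < 1 -> psi P s < psi P t.
Proof.
move=> s0 st t1; rewrite -subr_gt0 psiB; [|lra|lra].
apply: oriented_integral_gt0 fI _ s0 st t1 => z z01.
by have [+ _ _ _ _] := PA => /(_ _ z01)[a0 b0]; exact: divr_gt0.
Qed.

Lemma psi_nondecreasing (s t : R) :
  0 < s -> s <= t -> t < 1 -> psi P s <= psi P t.
Proof.
move=> s0; rewrite le_eqVlt => /predU1P[->//|st] t1.
exact/ltW/psi_increasing.
Qed.

Lemma psi_inj (s t : R) : 0 < s < 1 -> 0 < t < 1 ->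
  psi P s = psi P t -> s = t.
Proof.
move=> /andP[s0 s1] /andP[t0 t1] e.
have [st|ts|//] := ltgtP s t.
  by have := psi_increasing s0 st t1; rewrite e ltxx.
by have := psi_increasing t0 ts s1; rewrite e ltxx.
Qed.

Lemma psi_satD : psi P sD = 0.
Proof. exact: oriented_integralxx. Qed.

Lemma Psi_gradient (s t : R) : 0 < s < 1 -> 0 < t < 1 ->
  Psi P t - Psi P s <= psi P t * (t - s).
Proof.
move=> s01 t01.
have pI := nondecreasing_locally_integrable psi_nondecreasing.
rewrite /Psi (oriented_integralD pI sD01 s01 t01) addrC addKr.
exact: oriented_integral_nondecreasing_le psi_nondecreasing s01 t01.
Qed.

Lemma chem_potE S i : chem_pot P S ord0 i =
  ln (conc S i) - ln (conc (satD P) i) + psi P (tot S).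
Proof. by rewrite mxE. Qed.

Lemma chem_pot_satD : chem_pot P (satD P) = 0.
Proof. by apply/rowP => i; rewrite chem_potE subrr add0r psi_satD mxE. Qed.

(** In the concentrations [S_i / tot S] the entropy splits into [tot S] times
    a relative entropy and a function of the total saturation. *)
Lemma entropyE S : sat_domain S -> entropy P S =
  \sum_i S ord0 i * (ln (conc S i) - ln (conc (satD P) i)) + Psi P (tot S).
Proof.
move=> SD; have [S0 _] := SD; have /andP[s0 _] := sat_domain_tot n_gt0 SD.
have [D0 _] := satD_domain; have /andP[d0 _] := sD01.
rewrite /entropy {2}/tot mulr_suml -sumrB; congr (_ + _).
apply: eq_bigr => i _; rewrite /conc !ln_div ?posrE//; ring.
Qed.

(** Since [chem_pot P S] is the gradient of the entropy at [S], this is convexity.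
    The defect of the inequality is a relative entropy of concentrations, weighted
    by [tot S'], plus the defect for [Psi] at the total saturations. *)
Lemma entropy_gradient S S' : sat_domain S -> sat_domain S' ->
  entropy P S - entropy P S' <=
  \sum_i chem_pot P S ord0 i * (S ord0 i - S' ord0 i).
Proof.
move=> SD SD'; rewrite !entropyE//.
have /andP[s0 _] := sat_domain_tot n_gt0 SD.
have /andP[s0' _] := sat_domain_tot n_gt0 SD'.
(* The Gibbs inequality compares two probability vectors, so it is applied to the
   concentrations and then scaled back to saturations. *)
have G : \sum_i S' ord0 i * (ln (conc S i) - ln (conc S' i)) <= 0.
  have : \sum_i conc S' i * (ln (conc S i) - ln (conc S' i)) <= 0.
    apply: gibbs_inequality; rewrite ?(sum_conc n_gt0)// => i; exact: conc_gt0.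
  move=> /(mulr_ge0_le0 (ltW s0')); rewrite mulr_sumr.
  rewrite (eq_bigr (fun i => S' ord0 i * (ln (conc S i) - ln (conc S' i))))//.
  by move=> i _; rewrite {1}/conc; field; rewrite gt_eqF.
have := Psi_gradient (sat_domain_tot n_gt0 SD') (sat_domain_tot n_gt0 SD).
move=> H; rewrite -subr_le0.
suff -> : \sum_i S ord0 i * (ln (conc S i) - ln (conc (satD P) i)) + Psi P (tot S) -
   (\sum_i S' ord0 i * (ln (conc S' i) - ln (conc (satD P) i)) + Psi P (tot S')) -
   \sum_i chem_pot P S ord0 i * (S ord0 i - S' ord0 i) =
   \sum_i S' ord0 i * (ln (conc S i) - ln (conc S' i)) +
   (Psi P (tot S) - Psi P (tot S') - psi P (tot S) * (tot S - tot S')) by lra.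
have E : \sum_i chem_pot P S ord0 i * (S ord0 i - S' ord0 i) =
   \sum_i S ord0 i * (ln (conc S i) - ln (conc (satD P) i)) -
   \sum_i S' ord0 i * (ln (conc S' i) - ln (conc (satD P) i)) -
   \sum_i S' ord0 i * (ln (conc S i) - ln (conc S' i)) +
   psi P (tot S) * (tot S - tot S').
  rewrite {2 3}/tot -!sumrB mulr_sumr -big_split/=; apply: eq_bigr => i _.
  by rewrite chem_potE; ring.
by rewrite E; ring.
Qed.

End entropy.

(** * Cell means of the data *)

Section borel_rV.
Context {R : realType} {d : nat}.

(** The sigma-algebra is generated by the coordinates, while openness refers to the
    norm; an open set is the union of the countably many rational boxes that it
    contains. *)
Lemma open_measurable_rV (U : set 'rV[R]_d) : open U -> measurable U.
Proof.
move=> oU.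
pose box (pq : 'rV[rat]_d * 'rV[rat]_d) : set 'rV[R]_d :=
  \bigcap_(i in [set: 'I_d]) ((fun x : 'rV[R]_d => x ord0 i) @^-1`
    `]ratr (pq.1 ord0 i), ratr (pq.2 ord0 i)[).
have -> : U = \bigcup_pq (if `[< box pq `<=` U >] then box pq else set0).
  apply/seteqP; split=> [x Ux|x [pq _]]; last by case: asboolP => // + /=; apply.
  have /nbhs_ballP[e e0 xeU] : nbhs x U by exact: open_nbhs_nbhs.
  have lo i := cid (@rat_in_itvoo R (x ord0 i - e) (x ord0 i)
    ltac:(by rewrite ltrBlDr ltrDl)).
  have hi i := cid (@rat_in_itvoo R (x ord0 i) (x ord0 i + e)
    ltac:(by rewrite ltrDl)).
  exists (\row_i sval (lo i), \row_i sval (hi i)) => //.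
  set b := box _; have bU : b `<=` U.
    move=> y yb; apply: xeU; split => // i j; rewrite (ord1 i) /ball/= ltr_norml.
    have := yb j Logic.I; rewrite /= !mxE in_itv/=.
    have := svalP (lo j); have := svalP (hi j); rewrite !in_itv/=.
    by move=> /andP[? ?] /andP[? ?] /andP[? ?]; apply/andP; split; lra.
  rewrite asboolT// => i _ /=; rewrite !mxE in_itv/=.
  have := svalP (lo i); have := svalP (hi i); rewrite !in_itv/=.
  by move=> /andP[-> _] /andP[_ ->].
apply: countable_bigcupT_measurable => // pq; case: ifP => // _.
apply: fin_bigcap_measurable => // i _.
by rewrite -[X in measurable X]setTI; exact: measurable_coord.
Qed.

Lemma open_polytope_measurable (A : set 'rV[R]_d) : open_polytope A -> measurable A.
Proof.
move=> [m [N [c ->]]].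
have -> : [set x : 'rV[R]_d | forall j, (x *m N) ord0 j < c ord0 j] =
    \bigcap_(j in [set: 'I_m])
      ((fun x : 'rV[R]_d => \sum_i x ord0 i * N i j) @^-1` `]-oo, c ord0 j[).
  apply/seteqP; split=> x /= xA j.
    by move=> _ /=; have := xA j; rewrite mxE in_itv.
  by have := xA j Logic.I; rewrite /= in_itv/= mxE.
apply: fin_bigcap_measurable => // j _.
rewrite -[X in measurable X]setTI; apply: measurable_sum => // i.
by apply: measurable_funM => //; exact: measurable_coord.
Qed.

End borel_rV.

Section mean_value.
Context {d : measure_display} {T : measurableType d} {R : realType}.
Variables (mu : {measure set T -> \bar R}) (A : set T) (mA : measurable A).
Hypothesis A0 : fine (mu A) != 0.

Let A_fin : mu A \is a fin_num.
Proof.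
by move: A0; rewrite ge0_fin_numE//; case: (mu A) => [r| |]//=; rewrite ?ltry ?eqxx.
Qed.

Let A_gt0 : 0 < fine (mu A).
Proof. by rewrite lt_neqAle eq_sym A0 fine_ge0. Qed.

Definition mean (f : T -> R) : R := (fine (mu A))^-1 * \int[mu]_(x in A) f x.

Lemma mean_cst (c : R) : mean (cst c) = c.
Proof. by rewrite /mean Rintegral_cst// mulrC mulfK. Qed.

Lemma bounded_integrable (f : T -> R) (c C : R) : measurable_fun A f ->
  (forall x, A x -> c <= f x <= C) -> mu.-integrable A (EFin \o f).
Proof.
move=> mf fb; apply: measurable_bounded_integrable => //.
  by rewrite -ge0_fin_numE.
exists (`|c| + `|C|); split => // M gM t /= /fb /andP[cf fC].
apply/ltW/(le_lt_trans _ gM); rewrite ler_norml.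
have := ler_norm C; have := ler_norm (- c).
by rewrite normrN; have := normr_ge0 c; have := normr_ge0 C; lra.
Qed.

Lemma le_mean (f g : T -> R) :
  mu.-integrable A (EFin \o f) -> mu.-integrable A (EFin \o g) ->
  (forall x, A x -> f x <= g x) -> mean f <= mean g.
Proof.
by move=> fI gI fg; rewrite ler_wpM2l ?invr_ge0 ?(ltW A_gt0)// le_Rintegral.
Qed.

Lemma cst_integrable (c : R) : mu.-integrable A (EFin \o cst c).
Proof. by apply: (@bounded_integrable _ c c) => // x _; rewrite /= lexx. Qed.

Lemma mean_sum (I : Type) (s : seq I) (f : I -> T -> R) :
  (forall i, mu.-integrable A (EFin \o f i)) ->
  mu.-integrable A (EFin \o (fun x => \sum_(i <- s) f i x)) /\
  mean (fun x => \sum_(i <- s) f i x) = \sum_(i <- s) mean (f i).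
Proof.
move=> fI; elim: s => [|i s [sI sE]].
  under eq_fun do rewrite big_nil.
  by split; [exact: cst_integrable|rewrite big_nil mean_cst].
under eq_fun do rewrite big_cons.
split; first exact: (integrableD mA (fI i) sI).
by rewrite big_cons -sE /mean RintegralD// mulrDr.
Qed.

End mean_value.

Section means_on_cells.
Context {R : realType} {d n : nat} (D : fv_domain R d) (T : admissible_mesh D).
Context (P : model R n) (Phi : 'rV[R]_d -> R) (S0 : 'rV[R]_d -> 'rV[R]_n).
Hypothesis A1 : assumption_A1 D P Phi S0.
Implicit Types K : cell T.

Lemma cell_measure_ge0 K : 0 <= cell_measure K.
Proof. exact: fine_ge0. Qed.

Lemma cell_mean_porosity_ge0 K : 0 <= cell_mean K Phi.
Proof.
have [_ Phi01 _ _ _] := A1.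
apply: mulr_ge0; first by rewrite invr_ge0 cell_measure_ge0.
by apply: Rintegral_ge0 => x /cell_sub/Phi01/andP[].
Qed.

(** The saturation domain is convex, and the bounds [c] and [1 - c] keep the means
    away from its boundary.  Means are additive only for integrable functions, so
    measurability of the cell and of the initial data on it has to be
    established.  A nonzero [cell_measure] means positive and finite measure,
    because [fine] sends infinity to zero. *)
Lemma cell_mean_sat_domain K (S : 'rV[R]_n) : cell_measure K != 0 ->
  (forall i, S ord0 i = cell_mean K (fun x => S0 x ord0 i)) -> sat_domain S.
Proof.
move=> K0 SE; have [_ _ _ [mS0 _] [c /andP[c0 c1] S0c]] := A1.
have mK : measurable (cell_set K).
  by apply: open_polytope_measurable; exact: cell_polytope.
have mOmega : measurable (Omega D).
  by apply: open_measurable_rV; exact: Omega_open.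
have mi i : measurable_fun (cell_set K) (fun x => S0 x ord0 i : R).
  apply: (measurable_funS mOmega); first exact: cell_sub.
  by apply: (measurableT_comp (measurable_coord _)).
have S0K x i : cell_set K x -> c <= S0 x ord0 i <= 1 - c.
  move=> /cell_sub/S0c[Sc S1]; rewrite Sc/= (le_trans _ S1)// /tot.
  rewrite (bigD1 i)//= lerDl; apply: sumr_ge0 => j _.
  exact: le_trans (ltW c0) (Sc j).
have Si i := bounded_integrable mK K0 (mi i) (fun x => @S0K x i).
split=> [i|].
  rewrite SE; apply: (lt_le_trans c0).
  rewrite -[X in X <= _](mean_cst mK K0 c); apply: le_mean => //.
    exact: cst_integrable.
  by move=> x /(S0K _ i)/andP[].
apply: (@le_lt_trans _ _ (1 - c)); last lra.
rewrite /tot; under eq_bigr do rewrite SE.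
have [totI totE] := mean_sum mK K0 (index_enum 'I_n) Si.
rewrite -[X in X <= _]totE -[X in _ <= X](mean_cst mK K0 (1 - c)).
apply: le_mean => //; first exact: cst_integrable.
by move=> x /cell_sub/S0c[].
Qed.

End means_on_cells.

(** * Summation by parts on the mesh *)

Section euclidean.
Context {R : realType} {d : nat}.
Implicit Types x y : 'rV[R]_d.

Lemma dotv_ge0 x : 0 <= dotv x x.
Proof. by apply: sumr_ge0 => i _; rewrite -expr2 sqr_ge0. Qed.

Lemma sqr_enorm x : enorm x ^+ 2 = dotv x x.
Proof. by rewrite sqr_sqrtr// dotv_ge0. Qed.

Lemma enormB x y : enorm (x - y) = enorm (y - x).
Proof.
congr Num.sqrt; apply: eq_bigr => i _; rewrite !mxE; ring.
Qed.

Lemma edist_ge0 x A : 0 <= Defs.edist x A.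
Proof.
rewrite /Defs.edist; have [->|E0] := eqVneq [set enorm (x - y) | y in A] set0.
  by rewrite inf0.
by apply: lb_le_inf; [exact/set0P|move=> _ [y _ <-]; exact: sqrtr_ge0].
Qed.

End euclidean.

Section mesh.
Context {R : realType} {d : nat} {D : fv_domain R d} {T : admissible_mesh D}.
Implicit Types (K L : cell T) (s : edge T).

Lemma neighbor_unique K L s : L != K -> s \in edges_of L ->
  (forall J, s \in edges_of J -> (J == K) || (J == L)) ->
  neighbor K s = Some L.
Proof.
move=> LK sL sKL; rewrite /neighbor; case: pickP => [J /andP[JK sJ]|/(_ L)].
  by have := sKL J sJ; rewrite (negbTE JK) => /eqP ->.
by rewrite LK sL.
Qed.

Lemma neighbor_none K s : (forall J, s \in edges_of J -> J == K) ->
  neighbor K s = None.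
Proof.
move=> sK; rewrite /neighbor; case: pickP => // J /andP[JK /sK].
by rewrite (negbTE JK).
Qed.

(** The dichotomy between boundary edges and interfaces, in terms of the cells that
    contain the edge. *)
Lemma edge_cells K s : s \in edges_of K ->
  (neighbor K s = None /\ forall J, (s \in edges_of J) = (J == K)) \/
  exists L, [/\ L != K, neighbor K s = Some L, neighbor L s = Some K &
    forall J, (s \in edges_of J) = (J == K) || (J == L)].
Proof.
move=> sK; have [/mesh_ext[K' [sE _ _]]|/mesh_int] :=
  pselect (edge_set s `<=` bdry (Omega D)).
  move: sK; rewrite sE => /eqP ->; left; split=> //.
  by apply: neighbor_none => J; rewrite sE.
move=> [K1 [L1 [KL sE _ _ _]]]; right.
wlog e : K1 L1 KL sE / K = K1.
  move=> W; have := sK; rewrite sE => /orP[] /eqP e; first exact: (W K1 L1).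
  by apply: (W L1 K1) => //; [rewrite eq_sym|move=> J; rewrite orbC].
subst K1; exists L1; split=> //; first by rewrite eq_sym.
  by apply: neighbor_unique; rewrite ?sE ?eqxx ?orbT 1?eq_sym// => J; rewrite sE.
by apply: neighbor_unique; rewrite ?sE ?eqxx ?orbT// => J; rewrite sE orbC.
Qed.

Lemma transmissibility_ge0 K s : 0 <= transmissibility K s.
Proof.
apply: divr_ge0.
  by rewrite fine_ge0//; exact/ltW/edge_gt0.
by rewrite /edge_dist; case: neighbor => [L|]; rewrite ?sqrtr_ge0 ?edist_ge0.
Qed.

Section shared_edge.
Context {K L : cell T} {s : edge T}.
Hypotheses (KL : neighbor K s = Some L) (LK : neighbor L s = Some K).

Lemma transmissibilityC : transmissibility L s = transmissibility K s.
Proof. by rewrite /transmissibility /edge_dist KL LK enormB. Qed.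

Lemma jumpC (V : zmodType) (vD : V) (v : cell T -> V) :
  jump vD v L s = - jump vD v K s.
Proof. by rewrite /jump /edge_value KL LK opprB. Qed.

End shared_edge.

End mesh.

Section fluxes.
Context {R : realType} {d n : nat} {D : fv_domain R d} {T : admissible_mesh D}.
Context (P : model R n) (dt : R).
Implicit Types (S : cell T -> 'rV[R]_n) (K L : cell T) (s : edge T).

Lemma log_meanC (x y : R) : log_mean y x = log_mean x y.
Proof. by rewrite /log_mean -opprB -(opprB (ln y)) invrN mulrNN. Qed.

Section shared_edge.
Context {K L : cell T} {s : edge T} (S' S : cell T -> 'rV[R]_n).
Hypotheses (KL : neighbor K s = Some L) (LK : neighbor L s = Some K).

Let satKL : edge_sat P S K s = S L.
Proof. by rewrite /edge_sat /edge_value KL. Qed.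

Let satLK : edge_sat P S L s = S K.
Proof. by rewrite /edge_sat /edge_value LK. Qed.

Lemma conc_diff_setC : conc_diff_set P S L s = conc_diff_set P S K s.
Proof. by apply/setP => i; rewrite !inE satKL satLK eq_sym. Qed.

Lemma edge_mC : edge_m P S L s = edge_m P S K s.
Proof.
rewrite /edge_m conc_diff_setC satKL satLK; congr (_^-1 * _).
  by congr (_ - _); apply: eq_bigr => i; rewrite !inE negbK satKL => /eqP.
by apply: eq_bigr => i _; rewrite log_meanC.
Qed.

(** A component outside [conc_diff_set] has equal concentrations on both sides, so
    taking the value of either cell gives the same weight. *)
Lemma edge_concC i : edge_conc P S L s i = edge_conc P S K s i.
Proof.
rewrite /edge_conc edge_mC conc_diff_setC; case: ifPn => [_|].
  by rewrite satKL satLK log_meanC.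
by rewrite !inE negbK satKL => /eqP.
Qed.

Lemma edge_mobC : edge_mob P S L s = edge_mob P S K s.
Proof.
rewrite /edge_mob satKL satLK eq_sym; case: eqP => [->//|_].
by rewrite -opprB -(opprB (psi _ _)) invrN mulrNN.
Qed.

(** Local conservation: the edge coefficients are symmetric in the two cells and the
    jumps are antisymmetric. *)
Lemma fluxC i : flux P dt S' S L s i = - flux P dt S' S K s i.
Proof.
rewrite /flux (transmissibilityC KL LK) edge_concC edge_mobC (jumpC KL LK).
rewrite satKL satLK (addrC (S L)).
have -> : jump_chem P S L s = - jump_chem P S K s by exact: jumpC.
by under eq_bigr do rewrite mxE mulrN; rewrite sumrN; ring.
Qed.

End shared_edge.

(** On an interface the two fluxes are opposite, which leaves the difference of the
    potentials.  On a boundary edge the jump of the potential is minus its inner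
    value if the edge is Dirichlet; on a Neumann edge all jumps vanish, and with
    them the flux. *)
Lemma sum_by_parts S' S K s : s \in edges_of K ->
  \sum_(L | s \in edges_of L)
    \sum_i flux P dt S' S L s i * chem_pot P (S L) ord0 i =
  - \sum_i flux P dt S' S K s i * jump_chem P S K s ord0 i.
Proof.
move=> /edge_cells[[KN sE]|[L [LK nKL nLK sE]]].
  rewrite (big_pred1 K)// -sumrN; apply: eq_bigr => i _.
  rewrite /jump_chem /jump /edge_value KN; case: ifPn => [_|Dir].
    by rewrite sub0r [in RHS]mxE mulrN opprK.
  suff -> : flux P dt S' S K s i = 0 by rewrite !mul0r oppr0.
  have J (V : zmodType) (vD : V) (v : cell T -> V) : jump vD v K s = 0.
    by rewrite /jump /edge_value KN (negbTE Dir) subrr.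
  rewrite /flux J mulr0 sub0r big1 ?mulr0 ?oppr0// => j _.
  by rewrite /jump_chem J mxE mulr0.
rewrite (bigD1 K) ?sE ?eqxx//= (big_pred1 L); last first.
  move=> J; rewrite sE; case: eqVneq => [->|] /=; rewrite ?andbT ?andbF//.
  by rewrite eq_sym (negbTE LK).
rewrite -big_split -sumrN/=; apply: eq_bigr => i _.
rewrite (fluxC _ _ nKL nLK) /jump_chem /jump /edge_value nKL.
by rewrite !mxE; ring.
Qed.

End fluxes.

(** * Dissipation on one edge *)

Lemma log_mean_gt0 (R : realType) (x y : R) : 0 < x -> 0 < y -> x != y ->
  0 < log_mean x y.
Proof.
move=> x0 y0; rewrite neq_lt => /orP[xy|yx].
  by rewrite /log_mean divr_gt0// subr_gt0// ltr_ln.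
by rewrite -log_meanC /log_mean divr_gt0// subr_gt0// ltr_ln.
Qed.

Lemma log_meanK (R : realType) (x y : R) : 0 < x -> 0 < y -> x != y ->
  log_mean x y * (ln y - ln x) = y - x.
Proof.
move=> x0 y0 xy; rewrite divfK// subr_eq0; apply: contra xy => /eqP lnyx.
by apply/eqP/esym/ln_inj; rewrite ?posrE.
Qed.

Section edge_dissipation.
Context {R : realType} {d n : nat} {D : fv_domain R d} {T : admissible_mesh D}.
Context (n_gt0 : (0 < n)%N) (P : model R n) (dt : R).
Hypothesis PA : model_assumptions P.
Variables (S' S : cell T -> 'rV[R]_n) (K : cell T) (s : edge T).
Hypothesis SD : forall L, sat_domain (S L).

Let U := S K.
Let V := edge_sat P S K s.

Let UD : sat_domain U.
Proof. exact: SD. Qed.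

Let VD : sat_domain V.
Proof.
rewrite /V /edge_sat /edge_value; case: neighbor => [L|]; first exact: SD.
by case: ifP => _; [exact: satD_domain|exact: SD].
Qed.

(** The Dirichlet state is constant, so on every edge the jump of a function of the
    state is its difference between the states [V] and [U]; on a Neumann edge
    [V = U]. *)
Lemma jump_totE f : jump_tot P f S K s = f (tot V) - f (tot U).
Proof.
rewrite /jump_tot /jump /V /edge_sat /edge_value.
by case: neighbor => [L|]//; case: ifP.
Qed.

(** The value [0] prescribed for [mu] on Dirichlet edges is the chemical potential
    of the Dirichlet state. *)
Lemma jump_chemE : jump_chem P S K s = chem_pot P V - chem_pot P U.
Proof.
rewrite /jump_chem /jump /V /edge_sat /edge_value.
by case: neighbor => [L|]//; case: ifP; rewrite // chem_pot_satD.
Qed.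

Lemma jump_chem_coord i : jump_chem P S K s ord0 i =
  (ln (conc V i) - ln (conc U i)) + (psi P (tot V) - psi P (tot U)).
Proof. rewrite jump_chemE mxE [X in _ + X]mxE !chem_potE; ring. Qed.

Let N := conc_diff_set P S K s.

Let NC i : i \in ~: N -> conc U i = conc V i.
Proof. by rewrite !inE negbK => /eqP. Qed.

Let sumN (W : 'rV[R]_n) : sat_domain W ->
  1 - \sum_(i in ~: N) conc W i = \sum_(i in N) conc W i.
Proof.
move=> WD; rewrite -(sum_conc n_gt0 WD) (bigID (mem N))/=.
by under [X in _ - X]eq_bigl do rewrite inE; rewrite addrK.
Qed.

Let sum_log_mean_neq0 : N != finset.set0 ->
  \sum_(i in N) log_mean (conc U i) (conc V i) != 0 /\
  1 - \sum_(i in ~: N) conc U i != 0.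
Proof.
have pos (f : 'I_n -> R) : N != finset.set0 -> (forall i, i \in N -> 0 < f i) ->
    \sum_(i in N) f i != 0.
  move=> /set0Pn[i iN] f0; rewrite gt_eqF// (bigD1 i)//= ltr_pwDl ?f0//.
  by apply: sumr_ge0 => j /andP[jN _]; exact/ltW/f0.
move=> N0; rewrite sumN//; split; apply: pos => // i; last by rewrite conc_gt0.
by rewrite inE => iN; apply: log_mean_gt0 => //; exact: conc_gt0.
Qed.

(** The factor [edge_m] normalizes the logarithmic means so that they carry the mass
    of the components that change across the edge. *)
Lemma sum_edge_conc : \sum_i edge_conc P S K s i = 1.
Proof.
rewrite -(sum_conc n_gt0 UD) (bigID (mem N))/= [RHS](bigID (mem N))/=.
congr (_ + _); last by apply: eq_bigr => i /negbTE iN; rewrite /edge_conc iN.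
transitivity (\sum_(i in N) (edge_m P S K s)^-1 * log_mean (conc U i) (conc V i)).
  by apply: eq_bigr => i iN; rewrite /edge_conc iN.
have [->|/sum_log_mean_neq0[l0 c0]] := eqVneq N finset.set0.
  by rewrite !big_set0.
by rewrite -mulr_sumr /edge_m invfM invrK -sumN// divfK.
Qed.

(** Each product of a logarithmic mean and a jump of the logarithm is a jump of the
    concentration, and these jumps add up to zero because the concentrations sum
    to one in both states. *)
Lemma sum_edge_conc_log :
  \sum_i edge_conc P S K s i * (ln (conc V i) - ln (conc U i)) = 0.
Proof.
rewrite (bigID (mem N))/= [X in _ + X]big1 ?addr0; last first.
  by move=> i iN; rewrite NC ?subrr ?mulr0// inE.
transitivity (\sum_(i in N) (edge_m P S K s)^-1 * (conc V i - conc U i)).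
  apply: eq_bigr => i iN; rewrite /edge_conc iN -mulrA log_meanK//;
    try exact: conc_gt0.
  by move: iN; rewrite inE.
rewrite -mulr_sumr sumrB -!sumN//.
by rewrite -(eq_bigr _ NC) subrr mulr0.
Qed.

(** The discrete counterpart of [sum_i c_i * grad mu_i = grad psi]. *)
Lemma sum_edge_conc_jump :
  \sum_i edge_conc P S K s i * jump_chem P S K s ord0 i =
  psi P (tot V) - psi P (tot U).
Proof.
under eq_bigr do rewrite jump_chem_coord mulrDr.
by rewrite big_split/= sum_edge_conc_log -mulr_suml sum_edge_conc add0r mul1r.
Qed.

(** The discrete counterpart of [a * grad psi = grad beta].  Injectivity of [psi]
    excludes a zero denominator when the total saturations differ. *)
Lemma edge_mob_psi :
  edge_mob P S K s * (psi P (tot V) - psi P (tot U)) =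
  beta P (tot V) - beta P (tot U).
Proof.
rewrite /edge_mob -/U -/V; case: eqVneq => [->|VU]; first by rewrite !subrr mulr0.
rewrite divfK// subr_eq0; apply: contra VU => /eqP e; apply/eqP.
by apply: (psi_inj n_gt0 PA) e; exact: sat_domain_tot.
Qed.

Lemma jump_potential :
  jump (Pc P (tot (satD P))
        + (beta P (tot (satD P)) - beta P (tot (satD P))) / dt)
    (fun L => Pc P (tot (S L)) + (beta P (tot (S L)) - beta P (tot (S' L))) / dt)
    K s =
  jump_tot P (Pc P) S K s +
  (jump_tot P (beta P) S K s - jump_tot P (beta P) S' K s) / dt.
Proof.
rewrite /jump_tot /jump /edge_value.
by case: neighbor => [L|]; [ring|case: ifP => _; ring].
Qed.

(** Both capillary terms share the weight [c_{i,s} a_s], so the discrete chain rule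
    turns their product with [jump mu_i], summed over [i], into a product with
    [jump beta]. *)
Lemma flux_dissipation :
  \sum_i flux P dt S' S K s i * jump_chem P S K s ord0 i =
  - transmissibility K s * (jump_tot P (beta P) S K s *
    (jump_tot P (Pc P) S K s +
     (jump_tot P (beta P) S K s - jump_tot P (beta P) S' K s) / dt)) -
  transmissibility K s *
    quad_form (cross_diff P (2^-1 *: (U + V))) (jump_chem P S K s).
Proof.
set z := jump_chem P S K s; set M := cross_diff P _.
set X := jump_tot P (Pc P) S K s + _.
have -> : jump_tot P (beta P) S K s * X =
    \sum_i edge_mob P S K s * (edge_conc P S K s i * z ord0 i) * X.
  by rewrite -mulr_suml -mulr_sumr sum_edge_conc_jump edge_mob_psi jump_totE.
have -> : quad_form M z = \sum_i (\sum_j M i j * z ord0 j) * z ord0 i.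
  apply: eq_bigr => i _; rewrite mulr_suml; apply: eq_bigr => j _; ring.
rewrite !mulr_sumr -sumrB; apply: eq_bigr => i _.
rewrite /flux jump_potential -/X -/U -/V -/M -/z; ring.
Qed.

(** The edge state is the midpoint of two states of the convex saturation domain. *)
Lemma quad_form_coercive cM CM : assumption_A2 P cM CM ->
  cM * enorm (jump_chem P S K s *m Proj n) ^+ 2 <=
  quad_form (cross_diff P (2^-1 *: (U + V))) (jump_chem P S K s).
Proof.
move=> [_ _ _ _ MD]; rewrite sqr_enorm.
by have /andP[] := MD _ (jump_chem P S K s) (sat_domain_mid UD VD).
Qed.

Lemma edge_dissipation cM CM : assumption_A2 P cM CM -> 0 < dt ->
  dt * \sum_i flux P dt S' S K s i * jump_chem P S K s ord0 i <=
  2^-1 * (transmissibility K s * `|jump_tot P (beta P) S' K s| ^+ 2)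
  - 2^-1 * (transmissibility K s * `|jump_tot P (beta P) S K s| ^+ 2)
  - cM * dt * (transmissibility K s * enorm (jump_chem P S K s *m Proj n) ^+ 2)
  - dt * (transmissibility K s * jump_tot P (Pc P) S K s *
          jump_tot P (beta P) S K s).
Proof.
move=> /quad_form_coercive; set q := enorm _ ^+ 2; set Q := quad_form _ _ => qQ dt0.
rewrite flux_dissipation -/Q !real_normK ?num_real//.
set b := jump_tot P (beta P) S K s; set b' := jump_tot P (beta P) S' K s.
set p := jump_tot P (Pc P) S K s; set t := transmissibility K s.
have t0 : 0 <= t by exact: transmissibility_ge0.
have -> : dt * (- t * (b * (p + (b - b') / dt)) - t * Q) =
    - (dt * (t * p * b)) - t * (b * (b - b')) - dt * (t * Q).
  by field; rewrite gt_eqF.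
(* Together with e1 and e2, this is b (b - b') >= (b^2 - b'^2) / 2. *)
have h1 : 0 <= t * (b - b') ^+ 2 by rewrite mulr_ge0// sqr_ge0.
have h2 : dt * (t * (cM * q)) <= dt * (t * Q).
  by rewrite ler_wpM2l ?(ltW dt0)// ler_wpM2l.
have e1 : t * (b - b') ^+ 2 = t * b ^+ 2 - 2 * (t * (b * b')) + t * b' ^+ 2 by ring.
have e2 : t * (b * (b - b')) = t * b ^+ 2 - t * (b * b') by ring.
have e3 : cM * dt * (t * q) = dt * (t * (cM * q)) by ring.
by rewrite e2 e3; lra.
Qed.

End edge_dissipation.

(** * The energy inequality *)

Section energy_step.
Context {R : realType} {d n : nat} {D : fv_domain R d} {T : admissible_mesh D}.
Context (n_gt0 : (0 < n)%N) (P : model R n) (Phi : 'rV[R]_d -> R) (dt : R).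
Hypotheses (PA : model_assumptions P) (dt0 : 0 < dt).
Variables (S' S : cell T -> 'rV[R]_n) (rep : edge T -> cell T).
Hypothesis SS : scheme_step P Phi dt S' S.
Hypothesis repP : forall s, s \in edges_of (rep s).

(** Testing the scheme with [dt * mu_i] turns the discrete time derivative into the
    right-hand side of the gradient inequality of the entropy; the order of
    summation is then exchanged, so that each edge can be treated on its own. *)
Lemma summed_scheme :
  \sum_K cell_measure K * cell_mean K Phi *
    (\sum_i chem_pot P (S K) ord0 i * (S K ord0 i - S' K ord0 i)) =
  dt * \sum_s \sum_i flux P dt S' S (rep s) s i *
    jump_chem P S (rep s) s ord0 i.
Proof.
transitivity (- dt * \sum_K \sum_(s in edges_of K)
    \sum_i flux P dt S' S K s i * chem_pot P (S K) ord0 i).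
  rewrite mulr_sumr; apply: eq_bigr => K _.
  rewrite exchange_big !mulr_sumr; apply: eq_bigr => i _.
  rewrite -mulr_suml mulrA mulNr.
  have := SS K i => /eqP; rewrite addrC addr_eq0 => /eqP ->.
  by field; rewrite gt_eqF.
rewrite (exchange_big_dep predT)//= mulNr -mulrN -sumrN; congr (_ * _).
by apply: eq_bigr => s _; rewrite (sum_by_parts _ _ _ _ (repP s)) opprK.
Qed.

(** The previous state is only asked to lie in the domain on cells that carry mass:
    a cell mean is a convex combination of data only there. *)
Lemma energy_step cM CM : assumption_A2 P cM CM ->
  (forall K : cell T, 0 <= cell_mean K Phi) ->
  (forall K, sat_domain (S K)) ->
  (forall K : cell T, cell_measure K != 0 -> sat_domain (S' K)) ->
  discrete_energy P Phi rep S
  + cM * dt * \sum_s transmissibility (rep s) s *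
      enorm (jump_chem P S (rep s) s *m Proj n) ^+ 2
  + dt * \sum_s transmissibility (rep s) s *
      jump_tot P (Pc P) S (rep s) s * jump_tot P (beta P) S (rep s) s
  <= discrete_energy P Phi rep S'.
Proof.
move=> MA Phi0 SD SD'.
have cells : \sum_K cell_measure K * cell_mean K Phi * entropy P (S K) -
    \sum_K cell_measure K * cell_mean K Phi * entropy P (S' K) <=
    \sum_K cell_measure K * cell_mean K Phi *
      (\sum_i chem_pot P (S K) ord0 i * (S K ord0 i - S' K ord0 i)).
  rewrite -sumrB; apply: ler_sum => K _.
  have [->|mK] := eqVneq (cell_measure K) 0; first by rewrite !mul0r subrr.
  rewrite -mulrBr; apply: ler_wpM2l.
    by apply: mulr_ge0; [exact: cell_measure_ge0|exact: Phi0].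
  exact: (entropy_gradient n_gt0 PA (SD K) (SD' K mK)).
have edges : dt * \sum_s \sum_i flux P dt S' S (rep s) s i *
    jump_chem P S (rep s) s ord0 i <= \sum_s
  (2^-1 * (transmissibility (rep s) s * `|jump_tot P (beta P) S' (rep s) s| ^+ 2)
  - 2^-1 * (transmissibility (rep s) s * `|jump_tot P (beta P) S (rep s) s| ^+ 2)
  - cM * dt * (transmissibility (rep s) s *
      enorm (jump_chem P S (rep s) s *m Proj n) ^+ 2)
  - dt * (transmissibility (rep s) s * jump_tot P (Pc P) S (rep s) s *
          jump_tot P (beta P) S (rep s) s)).
  by rewrite mulr_sumr; apply: ler_sum => s _; exact: edge_dissipation MA dt0.
move: edges; rewrite !sumrB -!mulr_sumr -summed_scheme /discrete_energy.
by move: cells; lra.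
Qed.

End energy_step.

Theorem theorem1 (R : realType) (d n : nat) (d_ge1 : (1 <= d)%N)
    (n_ge1 : (1 <= n)%N) (D : fv_domain R d) (T : admissible_mesh D)
    (P : model R n) (Phi : 'rV[R]_d -> R) (S0 : 'rV[R]_d -> 'rV[R]_n)
    (cM CM dt : R) (S : nat -> cell T -> 'rV[R]_n)
    (rep : edge T -> cell T) :
  model_assumptions P ->
  assumption_A1 D P Phi S0 ->
  assumption_A2 P cM CM ->
  0 < dt ->
  (forall s, s \in edges_of (rep s)) ->
  (forall K i, S 0%N K ord0 i = cell_mean K (fun x => S0 x ord0 i)) ->
  forall k, (1 <= k)%N ->
  (forall l, (1 <= l <= k)%N ->
    scheme_step P Phi dt (S l.-1) (S l) /\
    forall K, (forall i, 0 < S l K ord0 i) /\ 0 < tot (S l K) < 1) ->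
  discrete_energy P Phi rep (S k)
  + cM * dt * \sum_s transmissibility (rep s) s *
      enorm (jump_chem P (S k) (rep s) s *m Proj n) ^+ 2
  + dt * \sum_s transmissibility (rep s) s *
      jump_tot P (Pc P) (S k) (rep s) s * jump_tot P (beta P) (S k) (rep s) s
  <= discrete_energy P Phi rep (S k.-1).
Proof.
move=> PA A1 A2 dt0 repP S0E k k1 scheme.
have SD l K : (1 <= l <= k)%N -> sat_domain (S l K).
  by move=> /scheme[_ /(_ K)[Spos /andP[_ S1]]].
have [Sk _] := scheme k (introT andP (conj k1 (leqnn k))).
apply: (energy_step n_ge1 PA dt0 Sk repP A2) => [K|K|K mK].
- exact: cell_mean_porosity_ge0 A1 K.
- by apply: SD; rewrite k1 leqnn.
- case: k k1 SD {scheme Sk} => [//|[|k]] _ SD /=.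
    exact: (cell_mean_sat_domain A1 mK (S0E K)).
  by apply: SD; rewrite leqnSn.
Qed.
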